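(* For any $m\geq1$ and $n\geq0$, the map $\varphi_3$ sending a word $u\in\mathbb{N}^n$ to the word $\varphi_3(u)$ of length $n$ with $\varphi_3(u)_i=u_i+i-1$ for all $1\leq i\leq n$ is a poset isomorphism from $\mathsf{Hi}_{\mathbf{m}-\mathbf{1}}(n)$ to $\mathcal{I}(\mathsf{Ca}_{\mathbf{m}})(n)$.
   Context: For an integer $m\geq0$, $\mathbf{m}$ is the map on positive integers $\mathbf{m}(i)=(i-1)m$; $\mathbf{m}-\mathbf{1}$ is the map $i\mapsto(i-1)(m-1)$. For such a map $\delta$, a $\delta$-cliff of size $n$ is a word $u=u_1\cdots u_n$ of nonnegative integers with $u_i\leq\delta(i)$ for all $i$. $\mathsf{Hi}_\delta(n)$ is the set of $\delta$-cliffs $u$ of size $n$ ($\delta$-hills) with $u_1\leq\cdots\leq u_n$. $\mathsf{Ca}_\delta(n)$ is the set of $\delta$-cliffs $u$ of size $n$ ($\delta$-canyons) such that $u_{i-j}\leq u_i-j$ for all $i\in\{1,\dots,n\}$ and all $j\in\{1,\dots,u_i\}$ with $i-j\geq1$. All sets of words of length $n$ are ordered componentwise. Let $\dim_n(\delta):=\#\{i\in\{1,\dots,n\}:\delta(i)\neq0\}$. The set $\mathcal{I}(\mathsf{Ca}_\delta)(n)$ of input-wings consists of the elements of $\mathsf{Ca}_\delta(n)$ covering exactly $\dim_n(\delta)$ elements in the poset $\mathsf{Ca}_\delta(n)$; it is a poset for the componentwise order. A poset isomorphism is a bijection $\phi$ with $x\preccurlyeq y\iff\phi(x)\preccurlyeq\phi(y)$.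 *)

(* Defs.v *)
From mathcomp Require Import all_boot all_order.
From mathcomp Require Import all_classical.

Set Implicit Arguments.
Unset Strict Implicit.
Unset Printing Implicit Defensive.

Import Order.Theory.
Local Open Scope classical_set_scope.
Local Open Scope card_scope.

(* Letters are stored from position 0: the letter u_(i+1) is [tnth u i].
   [n.-tupleprod nat] carries the componentwise order. *)
Notation word n := (n.-tupleprod nat).

(* Range maps delta are defined on positive integers; their value at 0 is
   never used. *)
Definition arith_map (m i : nat) : nat := (i - 1) * m.

Definition cliffs (delta : nat -> nat) (n : nat) : set (word n) :=
  [set u | forall i : 'I_n, tnth u i <= delta i.+1].

Definition hills (delta : nat -> nat) (n : nat) : set (word n) :=
  [set u | cliffs delta u /\ sorted leq u].

(* With positions counted from 0, the condition i - j >= 1 reads [j <= i]. *)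
Definition canyons (delta : nat -> nat) (n : nat) : set (word n) :=
  [set u | cliffs delta u /\
    forall (i : 'I_n) (j : nat), 1 <= j <= tnth u i -> j <= i ->
      nth 0 u (i - j) <= tnth u i - j].

(* x covers y (so y < x) in the subposet induced on P *)
Definition covers d (T : porderType d) (P : set T) (x y : T) : Prop :=
  [/\ P x, P y, (y < x)%O & ~ exists2 z, P z & (y < z < x)%O].

Definition dim (delta : nat -> nat) (n : nat) : nat :=
  #|[pred i : 'I_n | delta i.+1 != 0]|.

Definition input_wings (delta : nat -> nat) (n : nat) : set (word n) :=
  [set u | @canyons delta n u /\
           [set v | covers (@canyons delta n) u v] #= `I_(dim delta n)].

Definition poset_isomorphism d d' (T : porderType d) (T' : porderType d')
    (A : set T) (B : set T') (f : T -> T') : Prop :=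
  set_bij A B f /\
  forall x y, A x -> A y -> (x <= y)%O <-> (f x <= f y)%O.

Definition phi3 (n : nat) (u : word n) : word n :=
  [tuple tnth u i + i | i < n].

Arguments cliffs : clear implicits.
Arguments hills : clear implicits.
Arguments canyons : clear implicits.
Arguments input_wings : clear implicits.

(* Main.v *)
Require Import Defs.
From mathcomp Require Import all_boot all_order.
From mathcomp Require Import all_classical.
From mathcomp Require Import zify.

(** The heart of the matter is that, for every range map, a canyon [u] covers
    exactly as many canyons as it has nonzero letters. If [v < u] are canyons
    and [i] is the first position where they differ, replacing [u_i] by [v_i]
    in [u] gives a canyon between [v] and [u]: the condition at [i] only looks
    to the left, where [u] and [v] agree, and the conditions to the right of
    [i] only bound the lowered letter from above
    ([canyons_set_first_difference]). Hence every covering lowers a single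
    letter. Conversely, each nonzero letter [u_i] can be lowered, at worst to
    [0], and lowering it to the greatest possible value [lower u i] is a
    covering. This is [coversP], and [card_covers] counts.

    A letter of a cliff can be nonzero only where the range map is, so input
    wings are the canyons all of whose letters are nonzero wherever the range
    map allows it ([input_wingsP]). For [arith_map m] with [m >= 1] this means
    every letter but the first; the canyon condition at distance [1] then says
    that the word is strictly increasing, and conversely a word with strictly
    increasing letters satisfies all canyon conditions. Strictly increasing
    words [u] and weakly increasing words [v] correspond by
    [u_i = v_i + i - 1], and [u_i <= (i - 1) m] becomes
    [v_i <= (i - 1) (m - 1)]. *)

Set Implicit Arguments.
Unset Strict Implicit.
Unset Printing Implicit Defensive.

Import Order.Theory.

Lemma nth_word n (u : word n) (i : 'I_n) : nth 0 u i = tnth u i.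
Proof. exact: esym (tnth_nth 0 u i). Qed.

Lemma word_leP n (u v : word n) :
  reflect (forall i, tnth u i <= tnth v i) (u <= v)%O.
Proof. by rewrite leEtprod; apply: forallP. Qed.

(** Indexing both letters by positions makes the canyon condition free of
    truncated subtraction. *)
Lemma canyonsP delta n (u : word n) :
  canyons delta n u <->
  cliffs delta n u /\
  forall k i : 'I_n, k < i -> i <= tnth u i + k -> tnth u k + i <= tnth u i + k.
Proof.
split=> -[u_cliff u_canyon]; split=> //.
- move=> k i ltki le_i.
  have := u_canyon i (i - k); rewrite subKn 1?(ltnW ltki) // nth_word.
  rewrite subn_gt0 ltki leq_subLR addnC le_i leq_subr.
  by move=> /(_ isT isT); lia.
- move=> i j /andP[j_gt0 le_j_u] le_ji.
  have ltn_ij : i - j < n by have := ltn_ord i; lia.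
  move: (u_canyon (Ordinal ltn_ij) i) le_j_u.
  by rewrite -(nth_word u (Ordinal _)) /=; lia.
Qed.

Definition set_letter n (u : word n) (i : 'I_n) (c : nat) : word n :=
  [tuple if k == i then c else tnth u k | k < n].

Lemma tnth_set_letter n (u : word n) i c k :
  tnth (set_letter u i c) k = if k == i then c else tnth u k.
Proof. by rewrite tnth_mktuple. Qed.

Lemma set_letter_id n (u : word n) i : set_letter u i (tnth u i) = u.
Proof.
by apply: eq_from_tnth => k; rewrite tnth_set_letter; case: eqP => // ->.
Qed.

Lemma le_set_letter n (u : word n) i :
  {mono set_letter u i : c d / (c <= d)%O}.
Proof.
move=> c d; apply/word_leP/idP => [/(_ i)|le_cd k].
  by rewrite !tnth_set_letter eqxx.
by rewrite !tnth_set_letter; case: ifP.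
Qed.

Lemma lt_set_letter n (u : word n) i :
  {mono set_letter u i : c d / (c < d)%O}.
Proof. exact/leW_mono/le_set_letter. Qed.

Section Coverings.

Variables (delta : nat -> nat) (n : nat).
Implicit Types (u v : word n) (i : 'I_n).

Lemma canyons_set0 u i : canyons delta n u -> canyons delta n (set_letter u i 0).
Proof.
move=> /canyonsP[u_cliff u_canyon]; apply/canyonsP; split=> [k|k j ltkj].
  by rewrite tnth_set_letter; case: ifP.
have := u_canyon k j ltkj.
by rewrite !tnth_set_letter; case: (j == i); case: (k == i); lia.
Qed.

(** The first difference is essential: the condition at [i] for the new letter
    [tnth v i] is inherited from [v], whose letters left of [i] are those of
    [u]. *)
Lemma canyons_set_first_difference u v i :
    canyons delta n u -> canyons delta n v -> (v <= u)%O ->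
    (forall k : 'I_n, k < i -> tnth v k = tnth u k) ->
  canyons delta n (set_letter u i (tnth v i)).
Proof.
move=> /canyonsP[u_cliff u_canyon] /canyonsP[v_cliff v_canyon] /word_leP le_vu.
move=> eq_vu; apply/canyonsP; split=> [k|k j ltkj].
  by rewrite tnth_set_letter; case: eqP => // ->.
have := u_canyon k j ltkj; rewrite !tnth_set_letter.
case: (eqVneq j i) => [eq_ji|_]; case: (eqVneq k i) => [eq_ki|_] //.
- by move: ltkj; rewrite eq_ji eq_ki ltnn.
- by move=> _; rewrite eq_ji -(eq_vu k) -?eq_ji //; apply: v_canyon.
- by rewrite eq_ki; have := le_vu i; lia.
Qed.

Definition lower u i :=
  \max_(c < tnth u i | `[< canyons delta n (set_letter u i c) >]) c.

Lemma lowerP u i : canyons delta n u -> 0 < tnth u i ->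
  lower u i < tnth u i /\ canyons delta n (set_letter u i (lower u i)).
Proof.
move=> u_canyon u_gt0; rewrite /lower.
set P := fun c : 'I_(tnth u i) => `[< canyons delta n (set_letter u i c) >].
have P_gt0 : 0 < #|P|.
  by apply/card_gt0P; exists (Ordinal u_gt0); apply/asboolP/canyons_set0.
have [c /asboolP Pc ->] := eq_bigmax_cond (fun c : 'I_(tnth u i) => c : nat) P_gt0.
by split.
Qed.

Lemma lower_max u i c : c < tnth u i ->
  canyons delta n (set_letter u i c) -> c <= lower u i.
Proof.
move=> lt_cu /asboolP cP.
exact: (leq_bigmax_cond (F := fun c : 'I_(tnth u i) => c : nat) (Ordinal lt_cu)).
Qed.

(** Left to right, [i] is the first position where [v] and [u] differ: lowering
    [u_i] to [v_i] alone gives a canyon, so [v_i <= lower u i]; then lowering it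
    to [lower u i] gives a canyon between [v] and [u], hence [v]. Right to left,
    an element strictly between would differ from [u] at [i] only, against the
    maximality of [lower u i]. *)
Lemma coversP u v : canyons delta n u ->
  covers (canyons delta n) u v <->
  exists2 i, 0 < tnth u i & v = set_letter u i (lower u i).
Proof.
move=> u_canyon; split.
- case=> _ v_canyon lt_vu not_between.
  have [/existsP[i1 lt_i1] le_vu] : [exists i, tnth v i < tnth u i] /\ (v <= u)%O.
    by split; last exact: ltW; move: lt_vu; rewrite ltEtprod => /andP[].
  case: (@arg_minnP _ i1 (fun i => tnth v i < tnth u i) (@nat_of_ord n) lt_i1).
  move=> i lt_i i_min; exists i; first by lia.
  have [lt_low low_canyon] := lowerP u_canyon (leq_ltn_trans (leq0n _) lt_i).
  have eq_v c : c < tnth u i -> canyons delta n (set_letter u i c) ->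
      tnth v i <= c -> v = set_letter u i c.
    move=> lt_c c_canyon le_c; apply/eqP/negPn/negP => neq_v; apply: not_between.
    exists (set_letter u i c) => //; apply/andP; split.
      rewrite lt_neqAle neq_v; apply/word_leP => k; rewrite tnth_set_letter.
      by case: eqP => [->|_] //; apply/word_leP.
    by rewrite -[X in (_ < X)%O](set_letter_id u i) lt_set_letter ltEnat.
  apply: eq_v => //; apply: lower_max => //.
  apply: canyons_set_first_difference => // k lt_ki.
  have /word_leP/(_ k) := le_vu; have := i_min k; lia.
- case=> i u_gt0 ->; have [lt_low low_canyon] := lowerP u_canyon u_gt0.
  split=> //; first by rewrite -[X in (_ < X)%O](set_letter_id u i) lt_set_letter.
  case=> z z_canyon /andP[lt_low_z lt_zu].
  have eq_z : z = set_letter u i (tnth z i).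
    apply: eq_from_tnth => k; rewrite tnth_set_letter.
    case: eqP => [->|/eqP/negPf neq_ki] //; apply/eqP; rewrite eqn_leq.
    have /word_leP/(_ k) -> := ltW lt_zu.
    by have /word_leP/(_ k) := ltW lt_low_z; rewrite tnth_set_letter neq_ki.
  move: lt_zu lt_low_z; rewrite eq_z -[X in (_ < X)%O](set_letter_id u i).
  rewrite !lt_set_letter !ltEnat /= => lt_zu.
  by rewrite ltnNge lower_max // -eq_z.
Qed.

Lemma card_covers u : canyons delta n u ->
  ([set v | covers (canyons delta n) u v] #=
   `I_#|[pred i | 0 < tnth u i]|)%classic%card.
Proof.
move=> u_canyon; set p := [pred i | 0 < tnth u i].
pose f (a : 'I_#|p|) := set_letter u (enum_val a) (lower u (enum_val a)).
have f_inj : injective f.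
  move=> a b eq_fab; apply: enum_val_inj; apply/eqP/negPn/negP => neq_ab.
  have [lt_low _] := lowerP u_canyon (enum_valP a).
  move: (congr1 (fun w : word n => tnth w (enum_val a)) eq_fab).
  by rewrite !tnth_set_letter eqxx (negPf neq_ab); lia.
have -> : ([set v | covers (canyons delta n) u v] = f @` setT)%classic.
  apply/seteqP; split=> v /=.
    move=> /(coversP v u_canyon)[i u_gt0 ->].
    by exists (enum_rank_in (u_gt0 : i \in p) i) => //; rewrite /f enum_rankK_in.
  case=> a _ <-; apply/(coversP _ u_canyon).
  by exists (enum_val a) => //; exact: (enum_valP a).
apply: card_eq_trans (card_esym card_II).
by apply: inj_card_eq => a b _ _; apply: f_inj.
Qed.

(** Positions of nonzero letters of a cliff are among those where [delta] is
    nonzero, so the two sets are equal as soon as they have the same size. *)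
Lemma input_wingsP u :
  input_wings delta n u <->
  canyons delta n u /\ forall i : 'I_n, delta i.+1 != 0 -> 0 < tnth u i.
Proof.
pose p := [pred i | 0 < tnth u i]; pose q := [pred i : 'I_n | delta i.+1 != 0].
have cardE : canyons delta n u ->
    ([set v | covers (canyons delta n) u v] #= `I_(dim delta n))%classic%card
    <-> #|p| = #|q|.
  move=> /card_covers u_card; split=> [dim_card|eq_pq].
    exact/card_eq_II/(card_eq_trans (card_esym u_card) dim_card).
  by rewrite /dim -[#|_|]eq_pq.
have pq_sub : canyons delta n u -> p \subset q.
  move=> [u_cliff _]; apply/fintype.subsetP => i; rewrite !inE -lt0n => u_gt0.
  exact: leq_trans (u_cliff i).
split=> -[u_canyon u_cond]; split=> //.
  have /(cardE u_canyon)/eqP eq_card := u_cond.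
  move=> i qi; move: eq_card; rewrite (subset_leqif_card (pq_sub u_canyon)).
  by move=> /fintype.subsetP/(_ i qi).
apply/(cardE u_canyon)/eqP; rewrite (subset_leqif_card (pq_sub u_canyon)).
by apply/fintype.subsetP => i; apply: u_cond.
Qed.

End Coverings.

Lemma sorted_wordP n (u : word n) :
  sorted leq u <-> forall k i : 'I_n, k < i -> tnth u k <= tnth u i.
Proof.
split=> [u_sorted k i lt_ki|u_mono].
  rewrite -!nth_word; apply: (sorted_leq_nth leq_trans leqnn) => //;
  by [rewrite inE size_tuple | apply: ltnW].
apply/(sortedP 0) => i; rewrite size_tuple => lt_i.
have := u_mono (Ordinal (ltnW lt_i)) (Ordinal lt_i) (ltnSn i).
by rewrite -!nth_word.
Qed.

(** The canyon condition at distance [1] gives strict growth once the letters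
    are nonzero, hence [i <= tnth u i] by induction; so the canyon condition
    applies at every distance. *)
Lemma arith_input_wingsP m n (u : word n) : 0 < m ->
  input_wings (arith_map m) n u <->
  cliffs (arith_map m) n u /\
  forall k i : 'I_n, k < i -> tnth u k + i <= tnth u i + k.
Proof.
move=> m_gt0; split.
  move=> /input_wingsP[/canyonsP[u_cliff u_canyon] u_gt0]; split=> // k i lt_ki.
  apply: (u_canyon k i) => //; apply: (leq_trans _ (leq_addr _ _)).
  case: i {lt_ki} => i lt_i /=; elim: i lt_i => // i IHi lt_i.
  have := u_canyon (Ordinal (ltnW lt_i)) (Ordinal lt_i) (ltnSn i).
  have := IHi (ltnW lt_i); have := u_gt0 (Ordinal lt_i).
  rewrite /arith_map /= muln_eq0 subn1 /=; lia.
move=> [u_cliff u_grows]; apply/input_wingsP; split.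
  by apply/canyonsP; split=> // k i lt_ki _; apply: u_grows.
case=> [[|i] lt_i]; first by rewrite /arith_map subnn.
by have := u_grows (Ordinal (ltnW lt_i)) (Ordinal lt_i) (ltnSn i); rewrite /=; lia.
Qed.

Lemma tnth_phi3 n (u : word n) i : tnth (phi3 u) i = tnth u i + i.
Proof. by rewrite tnth_mktuple. Qed.

Lemma phi3_le n : {mono @phi3 n : u v / (u <= v)%O}.
Proof.
move=> u v; apply/word_leP/word_leP => le_uv i; have := le_uv i;
by rewrite !tnth_phi3 leq_add2r.
Qed.

Lemma phi3_input_wingsP m n (u : word n) : 0 < m ->
  input_wings (arith_map m) n (phi3 u) <-> hills (arith_map (m - 1)) n u.
Proof.
move=> m_gt0; rewrite arith_input_wingsP // /hills /= sorted_wordP.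
have cliffE i : (tnth (phi3 u) i <= arith_map m i.+1) =
                (tnth u i <= arith_map (m - 1) i.+1).
  by rewrite tnth_phi3 /arith_map subn1 /= mulnBr muln1; nia.
split=> -[u_cliff u_cond]; split=> [i|k i lt_ki].
- by rewrite -cliffE.
- by have := u_cond k i lt_ki; rewrite !tnth_phi3; lia.
- by rewrite cliffE.
- by have := u_cond k i lt_ki; rewrite !tnth_phi3; lia.
Qed.

Theorem theorem2p4p3 (m n : nat) (hm : 1 <= m) :
  poset_isomorphism (hills (arith_map (m - 1)) n)
                    (input_wings (arith_map m) n)
                    (@phi3 n).
Proof.
split; last by move=> u v _ _; rewrite phi3_le.
split=> [u u_hill|u v _ _ eq_uv|w w_wing]; first exact/phi3_input_wingsP.
  exact: (inc_inj (@phi3_le n)).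
pose u : word n := [tuple tnth w i - i | i < n].
suff phi_u : phi3 u = w by exists u => //; apply/(phi3_input_wingsP _ hm); rewrite phi_u.
apply: eq_from_tnth => i; rewrite tnth_phi3 tnth_mktuple subnK //.
have [_ w_grows] := (arith_input_wingsP w hm).1 w_wing.
case: (posnP i) => [-> //|i_gt0].
by have := w_grows (Ordinal (ltn_trans i_gt0 (ltn_ord i))) i i_gt0; rewrite /=; lia.
Qed.
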